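(* Let $\sigma_5=e^{-\pi i/9}\frac{\sqrt5+i\sqrt3}{2}$. (i) The group $\Gamma=\mathcal{S}(2,\sigma_5)$ is generated by $\mathrm{Stab}_\Gamma(m(P^5))\cup\mathrm{Stab}_\Gamma(m(B))$, where $P=R_1J$ and $B=R_2R_3^{-1}R_2^{-1}R_1R_2R_3R_2^{-1}$. (ii) The group $\Gamma=\mathcal{S}(4,\sigma_5)$ is generated by $\mathrm{Stab}_\Gamma(m(R_1))\cup\mathrm{Stab}_\Gamma(m(A))$, where $A$ can be taken to be any one of $(R_1R_2R_3R_2^{-1})^5$, $(R_1R_3^{-1}R_2R_3)^5$, $(R_1R_2^{-1}R_1^{-1}R_3R_1R_2)^5$, $(R_1R_3R_1R_2R_1^{-1}R_3^{-1})^5$.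
   Context: Let $p\ge2$ be an integer and $\tau\in\mathbb{C}$. Set $u=e^{2\pi i/(3p)}$, $\alpha=2-u^3-\bar u^3$, $\beta=(\bar u^2-u)\tau$ and $H=\begin{pmatrix}\alpha&\beta&\bar\beta\\ \bar\beta&\alpha&\beta\\ \beta&\bar\beta&\alpha\end{pmatrix}$, a Hermitian matrix (of signature $(2,1)$ for the parameters considered) defining the form $\langle X,Y\rangle=Y^*HX$. Let $R_1=\begin{pmatrix}u^2&\tau&-u\bar\tau\\0&\bar u&0\\0&0&\bar u\end{pmatrix}$, $J=\begin{pmatrix}0&0&1\\1&0&0\\0&1&0\end{pmatrix}$, $R_2=JR_1J^{-1}$, $R_3=JR_2J^{-1}$. The group $\mathcal{S}(p,\tau)$ is the subgroup of $U(H)$ generated by $R_1$ and $J$, acting on $H^2_{\mathbb{C}}=\{[X]:\langle X,X\rangle<0\}$ through its image in $PU(H)$; all statements refer to this image. The elements $P^5$, $B$, $R_1$ and the listed $A$ are complex reflections (non-identity elements fixing pointwise a complex line) in the relevant groups; for such an element $A$, $m(A)$ denotes its mirror (fixed complex line), and $\mathrm{Stab}_\Gamma(m)$ is the setwise stabilizer of $m$ in $\Gamma$. *)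

(* Defs.v *)
(* complex numbers R[i] over an arbitrary realType R
   (mathcomp-real-closed's complex.v), cos/sin/pi from mathcomp-analysis. *)
From mathcomp Require Import all_boot all_algebra.
From mathcomp Require Import reals trigo.
From mathcomp Require Export complex.
Set Implicit Arguments. Unset Strict Implicit. Unset Printing Implicit Defensive.
Import GRing.Theory Num.Theory.
Local Open Scope ring_scope.
Local Open Scope complex_scope.

Section DeformedTriangleGroups.
Variable R : realType.
Local Notation C := R[i].
Local Notation M3 := 'M[C]_3.

(* explicit 3x3 matrix given row by row *)
Definition mx3 (a b c d e f g h k : C) : M3 :=
  \matrix_(i < 3, j < 3)
    nth 0 (nth [::] [:: [:: a; b; c]; [:: d; e; f]; [:: g; h; k]] i) j.

(* e^{i theta} *)
Definition expi (theta : R) : C := cos theta +i* sin theta.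

(* u = e^{2 pi i/(3p)} *)
Definition uu (p : nat) : C := expi (2 * pi / (3 * p%:R)).

Definition alpha (p : nat) : C := 2 - uu p ^+ 3 - (uu p)^* ^+ 3.
Definition beta (p : nat) (tau : C) : C := (((uu p)^*) ^+ 2 - uu p) * tau.

(* the Hermitian matrix H *)
Definition Hmat (p : nat) (tau : C) : M3 :=
  let a := alpha p in let b := beta p tau in
  mx3 a b (b^*)  (b^*) a b  b (b^*) a.

(* <X, Y> = Y^* H X *)
Definition hform (H : M3) (X Y : 'cV[C]_3) : C :=
  ((map_mx (@conjc R) Y)^T *m H *m X) 0 0.

Definition R1 (p : nat) (tau : C) : M3 :=
  mx3 (uu p ^+ 2) tau (- uu p * tau^*)
      0 ((uu p)^*) 0
      0 0 ((uu p)^*).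

Definition Jmx : M3 := mx3 0 0 1  1 0 0  0 1 0.

Definition R2 (p : nat) (tau : C) : M3 := Jmx *m R1 p tau *m invmx Jmx.
Definition R3 (p : nat) (tau : C) : M3 := Jmx *m R2 p tau *m invmx Jmx.

(* subgroup of GL_3(C) generated by a set S of (invertible) matrices *)
Inductive gen (S : M3 -> Prop) : M3 -> Prop :=
  | gen_one : gen S 1%:M
  | gen_mul s g : S s -> gen S g -> gen S (s *m g)
  | gen_inv s g : S s -> gen S g -> gen S (invmx s *m g).

(* the matrix group S(p, tau) = < R1, J > *)
Definition Sgroup (p : nat) (tau : C) : M3 -> Prop :=
  gen (fun g => g = R1 p tau \/ g = Jmx).

(* negative vectors: the cone over H^2_C = { [X] : <X,X> < 0 } *)
Definition negvec (H : M3) (X : 'cV[C]_3) : Prop := hform H X X < 0.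

(* mirror m(A): the set of points of H^2_C fixed by A (described by the cone
   of negative vectors representing them; [X] is fixed iff A X = lambda X) *)
Definition mirror (H : M3) (A : M3) (X : 'cV[C]_3) : Prop :=
  negvec H X /\ exists lambda : C, A *m X = lambda *: X.

(* g stabilizes the (projective) set of points m setwise: g(m) = m *)
Definition stabilizes (m : 'cV[C]_3 -> Prop) (g : M3) : Prop :=
  forall X, m X <-> m (g *m X).

(* Stab_Gamma(m) *)
Definition Stab (G : M3 -> Prop) (m : 'cV[C]_3 -> Prop) (g : M3) : Prop :=
  G g /\ stabilizes m g.

(* sigma_5 = e^{-pi i/9} (sqrt 5 + i sqrt 3)/2 *)
Definition sigma5 : C :=
  expi (- (pi / 9)) * ((Num.sqrt 5 / 2) +i* (Num.sqrt 3 / 2)).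

(* elements appearing in the statement *)
Definition Pmx (p : nat) (tau : C) : M3 := R1 p tau *m Jmx.

Definition Bmx (p : nat) (tau : C) : M3 :=
  let r1 := R1 p tau in let r2 := R2 p tau in let r3 := R3 p tau in
  r2 *m invmx r3 *m invmx r2 *m r1 *m r2 *m r3 *m invmx r2.

Definition A1 (p : nat) (tau : C) : M3 :=
  let r1 := R1 p tau in let r2 := R2 p tau in let r3 := R3 p tau in
  (r1 *m r2 *m r3 *m invmx r2) ^+ 5.
Definition A2 (p : nat) (tau : C) : M3 :=
  let r1 := R1 p tau in let r2 := R2 p tau in let r3 := R3 p tau in
  (r1 *m invmx r3 *m r2 *m r3) ^+ 5.
Definition A3 (p : nat) (tau : C) : M3 :=
  let r1 := R1 p tau in let r2 := R2 p tau in let r3 := R3 p tau in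
  (r1 *m invmx r2 *m invmx r1 *m r3 *m r1 *m r2) ^+ 5.
Definition A4 (p : nat) (tau : C) : M3 :=
  let r1 := R1 p tau in let r2 := R2 p tau in let r3 := R3 p tau in
  (r1 *m r3 *m r1 *m r2 *m invmx r1 *m invmx r3) ^+ 5.

End DeformedTriangleGroups.

(* Main.v *)
From Stdlib Require Import ZArith.
Require Import Defs.
From mathcomp Require Import all_boot all_order all_algebra.
From mathcomp Require Import reals trigo complex.
From mathcomp Require Import ssrZ ring.
Set Implicit Arguments. Unset Strict Implicit. Unset Printing Implicit Defensive.
Import Order.TTheory GRing.Theory Num.Theory.
Local Open Scope ring_scope.

(* An element of U(H) commuting with A permutes the eigenvectors of A, hence
   stabilises the mirror of A. It therefore suffices to write the generators R1
   and J, up to scalars, as products of elements of the group that commute with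
   one of the two reflections. The scalars themselves lie in the group and
   stabilise everything. The required matrix identities hold in the ring of
   integers Z[phi, e^{i pi/6}], phi the golden ratio, because
   sigma_5 = e^{-i pi/9} (phi + e^{2 i pi/3}) and the factor e^{-i pi/9} can be
   removed by a diagonal conjugation and by rescaling J; there they are
   verified by computation. *)

(** * Generated subgroups and mirrors *)

Section Gen.
Variable R : realType.
Local Notation C := R[i].
Local Notation M3 := 'M[C]_3.
Local Notation conjmx A := (map_mx (@conjc R) A).
Implicit Types (S : M3 -> Prop) (g h A H : M3).

Lemma gen_mulmx S g h : gen S g -> gen S h -> gen S (g *m h).
Proof.
move=> Sg Sh; elim: Sg => [|s k Ss _ IH|s k Ss _ IH].
- by rewrite mul1mx.
- by rewrite -mulmxA; apply: gen_mul.
- by rewrite -mulmxA; apply: gen_inv.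
Qed.

Lemma invmx_mul g h : g \in unitmx -> h \in unitmx ->
  invmx (g *m h) = invmx h *m invmx g.
Proof. by move=> ug uh; apply: (@invrM M3 g h). Qed.

Lemma gen_mem S g : S g -> gen S g.
Proof. by move=> Sg; rewrite -[g]mulmx1; apply/gen_mul/gen_one. Qed.

(** The constructors of [gen] only multiply on the left, so the inverse is rebuilt in reverse order.
    The generators must be invertible because [invmx] returns a singular matrix unchanged. *)
Lemma gen_invmx S g : (forall s, S s -> s \in unitmx) ->
  gen S g -> g \in unitmx /\ gen S (invmx g).
Proof.
move=> Su; elim=> [|s k Ss _ [uk IH]|s k Ss _ [uk IH]].
- by rewrite unitmx1 invmx1; split=> //; exact: gen_one.
- have us := Su _ Ss; split; first by rewrite unitmx_mul us.
  have -> : invmx (s *m k) = invmx k *m (invmx s *m 1%:M).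
    by rewrite mulmx1 invmx_mul.
  by apply: gen_mulmx => //; apply: gen_inv => //; exact: gen_one.
- have us := Su _ Ss; split; first by rewrite unitmx_mul unitmx_inv us.
  have -> : invmx (invmx s *m k) = invmx k *m s.
    by rewrite invmx_mul ?invmxK ?unitmx_inv.
  by apply: gen_mulmx => //; apply: gen_mem.
Qed.

Lemma gen_trans S S' g : (forall s, S' s -> s \in unitmx) ->
  (forall s, S s -> gen S' s) -> gen S g -> gen S' g.
Proof.
move=> Su' SS'; elim=> [|s k Ss _ IH|s k Ss _ IH]; first exact: gen_one.
- by apply: gen_mulmx => //; apply: SS'.
- by apply: gen_mulmx => //; case: (gen_invmx Su' (SS' _ Ss)).
Qed.

Definition unitary H g := (conjmx g)^T *m H *m g = H.

Lemma unitary_mul H g h : unitary H g -> unitary H h -> unitary H (g *m h).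
Proof.
move=> Hg Hh; rewrite /unitary map_mxM trmx_mul -[RHS]Hh -[in RHS]Hg.
by rewrite !mulmxA.
Qed.

Lemma unitary_inv H g : g \in unitmx -> unitary H g -> unitary H (invmx g).
Proof.
move=> ug Hg; rewrite /unitary -{1}Hg -!mulmxA (mulmxV ug) mulmx1 !mulmxA.
by rewrite -trmx_mul -map_mxM (mulmxV ug) map_mx1 trmx1 mul1mx.
Qed.

Lemma unitary_gen H S g :
  (forall s, S s -> s \in unitmx /\ unitary H s) -> gen S g -> unitary H g.
Proof.
move=> SH; elim=> [|s k /SH[us Hs] _ IH|s k /SH[us Hs] _ IH].
- by rewrite /unitary map_mx1 trmx1 mul1mx mulmx1.
- exact: unitary_mul.
- by apply: unitary_mul => //; apply: unitary_inv.
Qed.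

Lemma negvec_unitary H g X : unitary H g -> negvec H (g *m X) <-> negvec H X.
Proof.
move=> Hg; rewrite /negvec /hform map_mxM trmx_mul.
have -> : (conjmx X)^T *m (conjmx g)^T *m H *m (g *m X) =
  (conjmx X)^T *m ((conjmx g)^T *m H *m g) *m X by rewrite !mulmxA.
by rewrite Hg.
Qed.

(** Commutation lets the same eigenvalue [l] serve for [X] and for [g *m X], and unitarity preserves
    negativity; the converse direction cancels [g]. *)
Lemma stabilizes_mirror H A g : g \in unitmx -> unitary H g ->
  g *m A = A *m g -> stabilizes (mirror H A) g.
Proof.
move=> ug Hg gA X; split=> -[nX [l Xl]]; (split; first by apply/(negvec_unitary X Hg)).
- by exists l; rewrite mulmxA -gA -mulmxA Xl scalemxAr.
- exists l; rewrite -[LHS](mulKmx ug) [g *m (A *m X)]mulmxA gA -mulmxA Xl.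
  by rewrite -scalemxAr mulKmx.
Qed.

End Gen.

(** * Roots of unity and the golden ratio *)

Section Roots.
Variable R : realType.
Local Notation C := R[i].
Local Open Scope complex_scope.

Lemma expiD (x y : R) : expi (x + y) = expi x * expi y.
Proof.
by rewrite /expi cosD sinD; apply/eqP; rewrite eq_complex /= eqxx addrC eqxx.
Qed.

Lemma expi0 : expi (0 : R) = 1.
Proof. by rewrite /expi cos0 sin0. Qed.

Lemma conj_expi (x : R) : (expi x)^* = expi (- x).
Proof. by rewrite /expi cosN sinN. Qed.

Lemma numconjE (x : C) : Num.conj x = conjc x.
Proof. by []. Qed.

Lemma mul_expi_conj (x : R) : expi x * conjc (expi x) = 1.
Proof. by rewrite conj_expi -expiD subrr expi0. Qed.

Lemma expi_neq0 (x : R) : expi x != 0.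
Proof.
have := mul_expi_conj x.
by apply: contra_eq_neq => ->; rewrite mul0r eq_sym oner_eq0.
Qed.

Definition z12 : C := expi (pi / 6).

Lemma z12_sq : z12 ^+ 2 = expi (pi / 3).
Proof. by rewrite expr2 -expiD; congr expi; field. Qed.

Lemma z12_pow6 : z12 ^+ 6 = -1.
Proof.
rewrite (_ : 6 = 2 * 3)%N // exprM z12_sq !exprS expr0 mulr1 -!expiD.
rewrite (_ : pi / 3 + _ = pi :> R); last by field.
by rewrite /expi cospi sinpi; apply/eqP; rewrite eq_complex /= oppr0 !eqxx.
Qed.

Lemma sin_pi3_gt0 : 0 < sin (pi / 3 : R).
Proof.
apply: sin_gt0_pi; rewrite divr_gt0 ?pi_gt0 //=.
by rewrite ltr_pdivrMr // ltr_pMr ?pi_gt0 // ltr1n.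
Qed.

(** This is the 12th cyclotomic relation: z^6 + 1 = (z^2 + 1)(z^4 - z^2 + 1), and z^2 + 1 does not
    vanish because z^2 has imaginary part sin(pi/3) > 0. *)
Lemma z12_min : z12 ^+ 4 = z12 ^+ 2 - 1.
Proof.
have zn : z12 ^+ 2 + 1 != 0.
  by rewrite z12_sq eq_complex /= negb_and addr0 (lt0r_neq0 sin_pi3_gt0) orbT.
apply: (mulfI zn); apply/eqP; rewrite -subr_eq0; apply/eqP.
transitivity (z12 ^+ 6 + 1); first by ring.
by rewrite z12_pow6 addNr.
Qed.

(** With w = e^{i pi/3}, [z12_min] reads w^2 = w - 1. Its imaginary part 2 sin cos = sin gives the
    cosine, its real part then gives sin^2 = 3/4, and positivity selects the root. *)
Lemma expi_pi3 : expi (pi / 3 : R) = (1 / 2) +i* (Num.sqrt 3 / 2).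
Proof.
have := z12_min; rewrite (_ : 4 = 2 * 2)%N // exprM z12_sq expr2 -expiD.
have s0 := sin_pi3_gt0.
have := cosD (pi / 3 : R) (pi / 3); have := sinD (pi / 3 : R) (pi / 3).
rewrite /expi => -> -> /eqP; rewrite eq_complex /= subr0 => /andP[/eqP e1 /eqP e2].
have c2 : cos (pi / 3 : R) = 1 / 2.
  apply: (mulfI (lt0r_neq0 s0)); apply/eqP; rewrite -subr_eq0; apply/eqP.
  transitivity ((sin (pi / 3) * cos (pi / 3) + cos (pi / 3) * sin (pi / 3) -
    sin (pi / 3 : R)) / 2); first by field.
  by rewrite e2 subrr mul0r.
have -> : sin (pi / 3 : R) = Num.sqrt 3 / 2; last by rewrite c2.
apply: (@pexpIrn _ 2) => //; rewrite ?nnegrE ?divr_ge0 ?sqrtr_ge0 ?ltW //.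
rewrite expr_div_n sqr_sqrtr // expr2.
have := e1; rewrite c2 => e3.
have {e3}-> : sin (pi / 3) * sin (pi / 3) = 1 / 2 * (1 / 2) - (1 / 2 - 1) :> R.
  by rewrite -e3; ring.
by field.
Qed.

Definition golden : C := ((1 + Num.sqrt 5) / 2)%:C.

Lemma golden_sq : golden ^+ 2 = golden + 1.
Proof.
rewrite /golden -rmorphXn -(rmorph1 (real_complex R)) -rmorphD; congr (_%:C).
rewrite expr_div_n sqrrD sqr_sqrtr //.
by field.
Qed.

Lemma conj_golden : golden^* = golden.
Proof. exact: conjc_real. Qed.

(** The conjugate is the inverse on the unit circle, and z (z - z^3) = z^2 - z^4 = 1. *)
Lemma conj_z12 : z12^* = z12 - z12 ^+ 3.
Proof.
have z0 : z12 != 0 := expi_neq0 _.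
apply: (mulfI z0); rewrite mul_expi_conj.
by transitivity (z12 ^+ 2 - z12 ^+ 4); [rewrite z12_min|]; ring.
Qed.

Lemma conj_z12_sq : conjc (z12 ^+ 2) = 1 - z12 ^+ 2.
Proof.
transitivity (conjc z12 ^+ 2); [exact: rmorphXn | rewrite conj_z12].
transitivity (z12 ^+ 2 - 2 * z12 ^+ 4 + z12 ^+ 6); first by ring.
by rewrite z12_min z12_pow6; ring.
Qed.

Definition c18 : C := expi (- (pi / 9)).

(** Although [c18] is not in Z[phi, z], its cube e^{-i pi/3} is. This is the only relation on powers
    of [c18] that the passage to the integer model uses. *)
Lemma c18_cube : c18 ^+ 3 = 1 - z12 ^+ 2.
Proof.
have -> : c18 ^+ 3 = expi (- (pi / 3)).
  by rewrite !exprS expr0 mulr1 -!expiD; congr expi; field.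
rewrite -conj_expi z12_sq expi_pi3.
apply/eqP; rewrite eq_complex /= sub0r eqxx andbT; apply/eqP.
by field.
Qed.

Lemma sigma5E : sigma5 R = c18 * (golden + z12 ^+ 2 - 1).
Proof.
rewrite /sigma5 z12_sq expi_pi3; congr (_ * _).
apply/eqP; rewrite eq_complex /=; apply/andP; split; apply/eqP.
all: by field.
Qed.

Lemma uu2E : uu R 2 = z12 ^+ 2.
Proof. by rewrite z12_sq; congr expi; field. Qed.

Lemma uu4E : uu R 4 = z12.
Proof. by congr expi; field. Qed.

End Roots.

(** * Exact matrix arithmetic *)

Section IntegerModel.
Local Open Scope Z_scope.

Definition qphi : Type := Z * Z.
Definition qadd (x y : qphi) : qphi := (x.1 + y.1, x.2 + y.2).
Definition qopp (x : qphi) : qphi := (- x.1, - x.2).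
(** Multiplication of numbers a + b phi, reduced by phi^2 = phi + 1. *)
Definition qmul (x y : qphi) : qphi :=
  (x.1 * y.1 + x.2 * y.2, x.1 * y.2 + x.2 * y.1 + x.2 * y.2).

(* [(x0, x1, x2, x3)] stands for x0 + x1 z + x2 z^2 + x3 z^3 with z = e^{i pi/6},
   so that z^4 = z^2 - 1, and coefficients [(a, b)] = a + b phi, phi golden. *)
Definition zphi : eqType := ((Z * Z) * (Z * Z) * (Z * Z) * (Z * Z))%type.
Definition tadd (x y : zphi) : zphi :=
  let '(x0, x1, x2, x3) := x in let '(y0, y1, y2, y3) := y in
  (qadd x0 y0, qadd x1 y1, qadd x2 y2, qadd x3 y3).
(** The product polynomial has degree 6 in z; its top coefficients are folded back by z^4 = z^2 - 1,
    z^5 = z^3 - z and z^6 = -1. *)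
Definition tmul (x y : zphi) : zphi :=
  let '(x0, x1, x2, x3) := x in let '(y0, y1, y2, y3) := y in
  let c0 := qmul x0 y0 in
  let c1 := qadd (qmul x0 y1) (qmul x1 y0) in
  let c2 := qadd (qmul x0 y2) (qadd (qmul x1 y1) (qmul x2 y0)) in
  let c3 := qadd (qadd (qmul x0 y3) (qmul x1 y2))
                 (qadd (qmul x2 y1) (qmul x3 y0)) in
  let c4 := qadd (qmul x1 y3) (qadd (qmul x2 y2) (qmul x3 y1)) in
  let c5 := qadd (qmul x2 y3) (qmul x3 y2) in
  let c6 := qmul x3 y3 in
  (qadd c0 (qopp (qadd c4 c6)), qadd c1 (qopp c5), qadd c2 c4, qadd c3 c5).

(** Matrices are plain tuples over binary integers, so that products and the equality test reduce
    under [vm_compute]. *)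
Definition zmx : eqType :=
  (zphi * zphi * zphi * zphi * zphi * zphi * zphi * zphi * zphi)%type.

Definition zmul (m n : zmx) : zmx :=
  let '(a, b, c, d, e, f, g, h, k) := m in
  let '(a', b', c', d', e', f', g', h', k') := n in
  let dot x y z x' y' z' := tadd (tmul x x') (tadd (tmul y y') (tmul z z')) in
  (dot a b c a' d' g', dot a b c b' e' h', dot a b c c' f' k',
   dot d e f a' d' g', dot d e f b' e' h', dot d e f c' f' k',
   dot g h k a' d' g', dot g h k b' e' h', dot g h k c' f' k').

Definition zzero : zphi := (0, 0, (0, 0), (0, 0), (0, 0)).
Definition zone : zphi := (1, 0, (0, 0), (0, 0), (0, 0)).
Definition zz : zphi := (0, 0, (1, 0), (0, 0), (0, 0)).
Definition zzi : zphi := (0, 0, (1, 0), (0, 0), (-1, 0)).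
Definition zz2 : zphi := (0, 0, (0, 0), (1, 0), (0, 0)).
Definition zz2i : zphi := (1, 0, (0, 0), (-1, 0), (0, 0)).
(** [ztau] is [sigma5] divided by [c18], and [zsig] is the conjugate of [sigma5] divided by
    [c18 ^+ 2]. *)
Definition ztau : zphi := (-1, 1, (0, 0), (1, 0), (0, 0)).
Definition zsig : zphi := (1, 0, (0, 0), (-1, 1), (0, 0)).
Definition zneg : zphi := (-1, 0, (0, 0), (0, 0), (0, 0)).

Definition zscal (x : zphi) : zmx :=
  (x, zzero, zzero, zzero, x, zzero, zzero, zzero, x).

Definition zR1 (u ui : zphi) : zmx :=
  (tmul u u, ztau, tmul zneg (tmul u zsig),
   zzero, ui, zzero, zzero, zzero, ui).
Definition zR1i (u ui : zphi) : zmx :=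
  (tmul ui ui, tmul zneg (tmul ui ztau), zsig,
   zzero, u, zzero, zzero, zzero, u).
(** Conjugating J by diag(1, c, c^2) and dividing by c, where c is [c18], leaves the corner entry
    c^-3 = z^2 and two entries 1. *)
Definition zJ : zmx :=
  (zzero, zzero, zz2, zone, zzero, zzero, zzero, zone, zzero).
Definition zJi : zmx :=
  (zzero, zone, zzero, zzero, zzero, zone, zz2i, zzero, zzero).

End IntegerModel.

(** * Evaluation of the integer model in the complex numbers *)

Section Eval.
Variable R : realType.
Local Notation C := R[i].
Local Notation phi := (golden R).
Local Notation z := (z12 R).

Definition evZ (n : Z) : C := (int_of_Z n)%:~R.
Definition evq (x : qphi) : C := evZ x.1 + evZ x.2 * phi.
Definition ev (x : zphi) : C :=
  let '(x0, x1, x2, x3) := x in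
  evq x0 + evq x1 * z + evq x2 * z ^+ 2 + evq x3 * z ^+ 3.

Lemma evZD m n : evZ (Z.add m n) = evZ m + evZ n.
Proof. by rewrite /evZ (rmorphD int_of_Z) rmorphD. Qed.

Lemma evZM m n : evZ (Z.mul m n) = evZ m * evZ n.
Proof. by rewrite /evZ (rmorphM int_of_Z) rmorphM. Qed.

Lemma evZN m : evZ (Z.opp m) = - evZ m.
Proof. by rewrite /evZ (rmorphN int_of_Z) rmorphN. Qed.

Lemma evqD x y : evq (qadd x y) = evq x + evq y.
Proof. by rewrite /evq /= !evZD; ring. Qed.

Lemma evqN x : evq (qopp x) = - evq x.
Proof. by rewrite /evq /= !evZN; ring. Qed.

Lemma evqM x y : evq (qmul x y) = evq x * evq y.
Proof.
rewrite /evq /= !(evZD, evZM).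
transitivity ((evZ x.1 + evZ x.2 * phi) * (evZ y.1 + evZ y.2 * phi)
  + evZ x.2 * evZ y.2 * (phi + 1 - phi ^+ 2)); first by ring.
by rewrite golden_sq subrr mulr0 addr0.
Qed.

Lemma evZ_small : (evZ Z0 = 0) * (evZ (Zpos xH) = 1) * (evZ (Zneg xH) = -1).
Proof. by rewrite /evZ !mulr1z mulrN1z. Qed.

Local Ltac ev_const := rewrite /ev /evq /= !evZ_small; ring.

Lemma ev_zzero : ev zzero = 0. Proof. by ev_const. Qed.
Lemma ev_zone : ev zone = 1. Proof. by ev_const. Qed.
Lemma ev_zneg : ev zneg = -1. Proof. by ev_const. Qed.
Lemma ev_zz : ev zz = z. Proof. by ev_const. Qed.
Lemma ev_zzi : ev zzi = z - z ^+ 3. Proof. by ev_const. Qed.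
Lemma ev_zz2 : ev zz2 = z ^+ 2. Proof. by ev_const. Qed.
Lemma ev_zz2i : ev zz2i = 1 - z ^+ 2. Proof. by ev_const. Qed.
Lemma ev_ztau : ev ztau = phi + z ^+ 2 - 1. Proof. by ev_const. Qed.
Lemma ev_zsig : ev zsig = phi * z ^+ 2 - z ^+ 2 + 1.
Proof. by ev_const. Qed.

Lemma evD x y : ev (tadd x y) = ev x + ev y.
Proof.
by case: x y => [[[x0 x1] x2] x3] [[[y0 y1] y2] y3]; rewrite /ev /= !evqD; ring.
Qed.

Lemma evM x y : ev (tmul x y) = ev x * ev y.
Proof.
case: x y => [[[x0 x1] x2] x3] [[[y0 y1] y2] y3]; rewrite /ev.
rewrite /tmul !(evqD, evqN, evqM).
set a0 := evq x0; set a1 := evq x1; set a2 := evq x2; set a3 := evq x3.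
set b0 := evq y0; set b1 := evq y1; set b2 := evq y2; set b3 := evq y3.
set c4 := a1 * b3 + a2 * b2 + a3 * b1; set c5 := a2 * b3 + a3 * b2.
(* The added term vanishes by [z12_min]; its first factor is the quotient of the degree 6 product by
   z^4 - z^2 + 1, where z^6 contributes z^2 + 1. *)
transitivity ((a0 + a1 * z + a2 * z ^+ 2 + a3 * z ^+ 3) *
    (b0 + b1 * z + b2 * z ^+ 2 + b3 * z ^+ 3) +
    (c4 + c5 * z + a3 * b3 * (z ^+ 2 + 1)) * (z ^+ 2 - 1 - z ^+ 4)).
  by rewrite /c4 /c5; ring.
by rewrite z12_min subrr mulr0 addr0.
Qed.

End Eval.

Section EvalMx.
Variable R : realType.
Local Notation C := R[i].

Definition evmx (m : zmx) : 'M[C]_3 :=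
  let '(a, b, c, d, e, f, g, h, k) := m in
  mx3 (ev R a) (ev R b) (ev R c) (ev R d) (ev R e) (ev R f)
      (ev R g) (ev R h) (ev R k).

Lemma mx3_mul (a b c d e f g h k a' b' c' d' e' f' g' h' k' : C) :
  mx3 a b c d e f g h k *m mx3 a' b' c' d' e' f' g' h' k' =
  mx3 (a * a' + (b * d' + c * g')) (a * b' + (b * e' + c * h'))
      (a * c' + (b * f' + c * k')) (d * a' + (e * d' + f * g'))
      (d * b' + (e * e' + f * h')) (d * c' + (e * f' + f * k'))
      (g * a' + (h * d' + k * g')) (g * b' + (h * e' + k * h'))
      (g * c' + (h * f' + k * k')).
Proof.
apply/matrixP=> i j; rewrite !mxE !big_ord_recl big_ord0 !mxE /= addr0.
by case: i => [[|[|[|//]]] ?]; case: j => [[|[|[|//]]] ?].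
Qed.

Lemma mx3_scale (x a b c d e f g h k : C) :
  x *: mx3 a b c d e f g h k =
  mx3 (x * a) (x * b) (x * c) (x * d) (x * e) (x * f) (x * g) (x * h) (x * k).
Proof.
apply/matrixP=> i j; rewrite !mxE.
by case: i => [[|[|[|//]]] ?]; case: j => [[|[|[|//]]] ?].
Qed.

Lemma mx3_conjT (a b c d e f g h k : C) :
  (map_mx (@conjc R) (mx3 a b c d e f g h k))^T =
  mx3 (conjc a) (conjc d) (conjc g) (conjc b) (conjc e) (conjc h)
      (conjc c) (conjc f) (conjc k).
Proof.
apply/matrixP=> i j; rewrite !mxE.
by case: i => [[|[|[|//]]] ?]; case: j => [[|[|[|//]]] ?].
Qed.

Lemma scalar_mx3 (x : C) : x%:M = mx3 x 0 0 0 x 0 0 0 x.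
Proof.
apply/matrixP=> i j; rewrite !mxE.
by case: i => [[|[|[|//]]] ?]; case: j => [[|[|[|//]]] ?].
Qed.

Lemma evmxM m n : evmx (zmul m n) = evmx m *m evmx n.
Proof.
case: m n => [[[[[[[[a b] c] d] e] f] g] h] k] [[[[[[[[a' b'] c'] d'] e'] f'] g'] h'] k'].
by rewrite /evmx mx3_mul /zmul !(evD, evM).
Qed.

Lemma evmx_scal x : evmx (zscal x) = (ev R x)%:M.
Proof.
by rewrite scalar_mx3 /evmx /zscal ev_zzero.
Qed.

End EvalMx.

(** * Words in the generators *)

Section Unitarity.
Variable R : realType.
Local Notation C := R[i].

Lemma uu_neq0 p : uu R p != 0.
Proof. exact: expi_neq0. Qed.

Lemma uu_conj p : conjc (uu R p) = (uu R p)^-1.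
Proof. by apply: (mulfI (uu_neq0 p)); rewrite mul_expi_conj mulfV ?uu_neq0. Qed.

Lemma R1_unitary p (tau : C) : unitary (Hmat p tau) (R1 p tau).
Proof.
rewrite /unitary /Hmat /R1 /beta /alpha mx3_conjT !numconjE.
(* Only conj u = u^-1 matters from here on: the nine entries become rational identities in u, tau
   and conj tau. *)
move: (uu R p) (uu_neq0 p) (uu_conj p) => u u0 uc.
rewrite !(rmorphM, rmorphB, rmorphN, rmorphXn, rmorph0, conjcK) /= !conjcK.
rewrite uc !mx3_mul.
by congr mx3; field.
Qed.

Lemma Jmx_unitary p (tau : C) : unitary (Hmat p tau) (Jmx R).
Proof.
rewrite /unitary /Hmat /Jmx mx3_conjT conjc0 conjc1 !mx3_mul.
by congr mx3; ring.
Qed.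

End Unitarity.

Inductive letter := r | r' | j | j'.

Section Words.
Variables (R : realType) (p : nat) (u ui : zphi).
Hypotheses (uE : ev R u = uu R p) (uiE : ev R ui = conjc (uu R p)).
Hypothesis zR1K : zmul (zR1i u ui) (zR1 u ui) = zscal zone.
Local Notation C := R[i].
Local Notation M3 := 'M[C]_3.
Local Notation tau := (sigma5 R).
Local Notation c := (c18 R).
Implicit Types (w : seq letter).

Definition lmx l : M3 :=
  match l with
  | r => R1 p tau | r' => invmx (R1 p tau) | j => Jmx R | j' => invmx (Jmx R)
  end.
Definition wmx w : M3 := foldr (fun l M => lmx l *m M) 1%:M w.

Definition cdiag : M3 := mx3 1 0 0 0 c 0 0 0 (c ^+ 2).

Lemma c18_neq0 : c != 0.
Proof. exact: expi_neq0. Qed.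

Lemma cdiag_unit : cdiag \in unitmx.
Proof.
have c0 := c18_neq0.
suff /mulmx1_unit[] : cdiag *m mx3 1 0 0 0 c^-1 0 0 0 (c ^- 2) = 1%:M by [].
rewrite mx3_mul scalar_mx3.
by congr mx3; field.
Qed.

(* Conjugation by [cdiag] turns R1 and [c^-1 J] into matrices over Z[phi, z12],
   avoiding a cubic extension of the coefficient ring by [c]. *)
Definition models (M : M3) (m : zmx) :=
  exists2 x : C, x != 0 & cdiag *m M = x *: (evmx R m *m cdiag).

Lemma models_mul M N m n : models M m -> models N n -> models (M *m N) (zmul m n).
Proof.
move=> [x x0 Mm] [y y0 Nn]; exists (x * y); first exact: mulf_neq0.
by rewrite mulmxA Mm -scalemxAl -mulmxA Nn -scalemxAr scalerA evmxM mulmxA.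
Qed.

Lemma models1 : models 1%:M (zscal zone).
Proof. by exists 1; rewrite ?oner_eq0 // mulmx1 evmx_scal ev_zone mul1mx scale1r. Qed.

(** Invertibility of [M] comes from the model: x^-1 D^-1 m' D, with D = [cdiag], is a left
    inverse. *)
Lemma models_inv M m m' : models M m -> zmul m' m = zscal zone ->
  M \in unitmx /\ models (invmx M) m'.
Proof.
move=> [x x0 Mm] m'm.
have mK : evmx R m' *m evmx R m = 1%:M by rewrite -evmxM m'm evmx_scal ev_zone.
have e : evmx R m' *m cdiag *m M = x *: cdiag.
  by rewrite -mulmxA Mm -scalemxAr mulmxA mK mul1mx.
have uM : M \in unitmx.
  have /mulmx1_unit[] // : (x^-1 *: (invmx cdiag *m evmx R m' *m cdiag)) *m M = 1%:M.
  rewrite -scalemxAl -!mulmxA [evmx R m' *m _]mulmxA e -scalemxAr.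
  by rewrite (mulVmx cdiag_unit) scalerA mulVf // scale1r.
split=> //; exists x^-1; first by rewrite invr_eq0.
rewrite -[evmx R m' *m cdiag](mulmxK uM) e -scalemxAl scalerA mulVf //.
by rewrite scale1r.
Qed.

(** The unknown scalars enter both products as x y and y x, so commutation of the models gives exact
    commutation, not merely commutation up to a scalar. *)
Lemma models_comm M N m n : models M m -> models N n ->
  zmul m n = zmul n m -> M *m N = N *m M.
Proof.
move=> Mm Nn mn; have [x x0 Mm'] := Mm; have [y y0 Nn'] := Nn.
apply: (can_inj (mulKmx cdiag_unit)).
rewrite !mulmxA Mm' Nn' -!scalemxAl -!mulmxA Mm' Nn' -!scalemxAr !scalerA.
by rewrite !mulmxA -!evmxM mn mulrC.
Qed.

Lemma models_scal M t : models M (zscal t) -> exists x, M = x%:M.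
Proof.
move=> [x x0 Mm]; exists (x * ev R t); apply: (can_inj (mulKmx cdiag_unit)).
by rewrite Mm evmx_scal mul_scalar_mx mul_mx_scalar scalerA.
Qed.

Definition lz l : zmx :=
  match l with
  | r => zR1 u ui | r' => zR1i u ui | j => zJ | j' => zJi
  end.
Definition zword w : zmx := foldr (fun l => zmul (lz l)) (zscal zone) w.

Lemma models_J : models (Jmx R) zJ.
Proof.
exists c; first exact: c18_neq0.
rewrite /Jmx /cdiag /zJ /evmx !mx3_mul mx3_scale ev_zzero ev_zone ev_zz2.
congr mx3; rewrite ?(mul0r, mulr0, mul1r, mulr1, addr0, add0r) //.
(* Only the corner entry is left: z^2 c^3 = z^2 (1 - z^2) = z^2 - z^4 = 1. *)
transitivity (z12 R ^+ 2 * c ^+ 3); last by ring.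
rewrite c18_cube; transitivity (z12 R ^+ 2 - z12 R ^+ 4); last by ring.
by rewrite z12_min; ring.
Qed.

Lemma conj_sigma5 : conjc tau = c ^+ 2 * (golden R * z12 R ^+ 2 - z12 R ^+ 2 + 1).
Proof.
have conjE (a b d : C) : conjc (a * (b + d ^+ 2 - 1)) =
    conjc a * (conjc b + conjc (d ^+ 2) - 1).
  by rewrite rmorphM rmorphB rmorphD rmorph1.
rewrite sigma5E conjE conj_golden conj_z12_sq.
(* Multiplying by [c] cancels its conjugate on the left and produces c^3 on the right, which
   [c18_cube] evaluates in Z[phi, z]. *)
apply: (mulfI c18_neq0); rewrite mulrA mul_expi_conj mul1r mulrA -exprS.
rewrite c18_cube.
transitivity (golden R * (z12 R ^+ 2 - z12 R ^+ 4) + 1 - 2 * z12 R ^+ 2 + z12 R ^+ 4);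
  last by ring.
by rewrite z12_min; ring.
Qed.

Lemma models_R1 : models (R1 p tau) (zR1 u ui).
Proof.
exists 1; first exact: oner_neq0.
rewrite scale1r /R1 /cdiag /zR1 /evmx !mx3_mul !evM uE uiE numconjE.
rewrite ev_zzero ev_ztau ev_zneg ev_zsig conj_sigma5 sigma5E.
by congr mx3; ring.
Qed.

Lemma models_lmx l : lmx l \in unitmx /\ models (lmx l) (lz l).
Proof.
have [R1u R1i] := models_inv models_R1 zR1K.
have [Ju Ji] : Jmx R \in unitmx /\ models (invmx (Jmx R)) zJi.
  by apply: (models_inv models_J); vm_compute.
case: l; rewrite ?unitmx_inv; split=> //; [exact: models_R1 | exact: models_J].
Qed.

Lemma models_word w : models (wmx w) (zword w).
Proof.
elim: w => [|l w IH]; first exact: models1.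
by apply: models_mul => //; case: (models_lmx l).
Qed.

Lemma wmx_cat w w' : wmx (w ++ w') = wmx w *m wmx w'.
Proof. by elim: w => [|l w IH] /=; rewrite ?mul1mx // IH mulmxA. Qed.

Lemma wmx_flatten_nseq n w : wmx (flatten (nseq n w)) = wmx w ^+ n.
Proof. by elim: n => [|n IH] //=; rewrite wmx_cat IH exprS. Qed.

Lemma Sgroup_wmx w : Sgroup p tau (wmx w).
Proof.
elim: w => [|l w IH]; first exact: gen_one.
by case: l => /=; [apply: gen_mul | apply: gen_inv | apply: gen_mul | apply: gen_inv];
  auto.
Qed.

Lemma Sgroup_unit g : Sgroup p tau g -> g \in unitmx.
Proof.
move=> Gg; apply: (proj1 (gen_invmx _ Gg)) => s [] ->.
- by case: (models_lmx r).
- by case: (models_lmx j).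
Qed.

Lemma Sgroup_unitary g : Sgroup p tau g -> unitary (Hmat p tau) g.
Proof.
apply: unitary_gen => s [] ->; split.
- by case: (models_lmx r).
- exact: R1_unitary.
- by case: (models_lmx j).
- exact: Jmx_unitary.
Qed.

Definition two_stabs (A B h : M3) :=
  Stab (Sgroup p tau) (mirror (Hmat p tau) A) h \/
  Stab (Sgroup p tau) (mirror (Hmat p tau) B) h.

Lemma two_stabs_unit A B h : two_stabs A B h -> h \in unitmx.
Proof. by case=> -[/Sgroup_unit]. Qed.

Lemma Stab_commute A w : wmx w *m A = A *m wmx w ->
  Stab (Sgroup p tau) (mirror (Hmat p tau) A) (wmx w).
Proof.
move=> wA; split; first exact: Sgroup_wmx.
apply: stabilizes_mirror wA; first exact/Sgroup_unit/Sgroup_wmx.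
exact/Sgroup_unitary/Sgroup_wmx.
Qed.

Definition zcomm (m n : zmx) := zmul m n == zmul n m.
Definition is_zscal (m : zmx) :=
  let '(x, _, _, _, _, _, _, _, _) := m in m == zscal x.
(** A certificate exhibits [w], up to a scalar, as the inverse of a product of words each
    centralising one of the two reflections. Asking for a scalar product compares elements in PU(H)
    without inverting any word. *)
Definition certifies wA wB (ws : seq (seq letter)) w :=
  let a := zword wA in let b := zword wB in
  all (fun v => let m := zword v in zcomm m a || zcomm m b) ws &&
  is_zscal (zword (flatten ws ++ w)).

Lemma gen_flatten S (P : pred (seq letter)) ws :
  (forall v, P v -> S (wmx v)) -> all P ws -> gen S (wmx (flatten ws)).
Proof.
move=> PS; elim: ws => [_|v ws IH]; first exact: gen_one.
rewrite [all _ _]/(P v && all P ws) [flatten _]/(v ++ flatten ws) wmx_cat.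
by case/andP=> /PS Sv /IH; apply: gen_mul.
Qed.

(* The product of [flatten ws] and [w] acts trivially on H^2, hence lies in
   both stabilisers. *)
Lemma certificate wA wB ws w : certifies wA wB ws w ->
  gen (two_stabs (wmx wA) (wmx wB)) (wmx w).
Proof.
move=> /andP[wsP sP].
have comm v v' : zcomm (zword v) (zword v') -> wmx v *m wmx v' = wmx v' *m wmx v.
  by move/eqP; apply: models_comm; apply: models_word.
have genK : gen (two_stabs (wmx wA) (wmx wB)) (wmx (flatten ws)).
  apply: gen_flatten wsP => v.
  by case/orP=> /comm; [left | right]; apply: Stab_commute.
have [x xE] : exists x, wmx (flatten ws ++ w) = x%:M.
  have := models_word (flatten ws ++ w); move: sP.
  case: (zword _) => [[[[[[[[t ?] ?] ?] ?] ?] ?] ?] ?] /eqP ->.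
  exact: models_scal.
have uK : wmx (flatten ws) \in unitmx by exact/Sgroup_unit/Sgroup_wmx.
have -> : wmx w = invmx (wmx (flatten ws)) *m wmx (flatten ws ++ w).
  by rewrite wmx_cat mulKmx.
apply: gen_mulmx; first by case: (gen_invmx (@two_stabs_unit _ _) genK).
by apply/gen_mem; left; apply: Stab_commute; rewrite xE scalar_mxC.
Qed.

Lemma two_stabs_generate A B :
  gen (two_stabs A B) (R1 p tau) -> gen (two_stabs A B) (Jmx R) ->
  forall g, Sgroup p tau g -> gen (two_stabs A B) g.
Proof.
move=> gR gJ g; apply: gen_trans; first exact: two_stabs_unit.
by move=> s [] ->.
Qed.

Definition w1 := [:: r].
Definition w2 := [:: j; r; j'].
Definition w3 := [:: j; j; r; j'; j'].

Lemma R2E : R2 p tau = wmx w2.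
Proof. by rewrite /R2 /= mulmx1 mulmxA. Qed.

Lemma R3E : R3 p tau = wmx w3.
Proof. by rewrite /R3 /R2 /= mulmx1 !mulmxA. Qed.

Lemma R1E : R1 p tau = wmx w1.
Proof. by rewrite /= mulmx1. Qed.

Definition linv l := match l with r => r' | r' => r | j => j' | j' => j end.
Definition winv w := rev (map linv w).

Lemma wmx_inv w : invmx (wmx w) = wmx (winv w).
Proof.
rewrite /winv; elim: w => [|l w IH] /=; first exact: invmx1.
rewrite rev_cons -cats1 wmx_cat -IH invmx_mul /=; first last.
- exact/Sgroup_unit/Sgroup_wmx.
- by case: (models_lmx l).
by rewrite mulmx1; case: l => //=; rewrite invmxK.
Qed.

Definition wP5 := flatten (nseq 5 [:: r; j]).
Definition wB := w2 ++ winv w3 ++ winv w2 ++ w1 ++ w2 ++ w3 ++ winv w2.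
Definition wA1 := flatten (nseq 5 (w1 ++ w2 ++ w3 ++ winv w2)).
Definition wA2 := flatten (nseq 5 (w1 ++ winv w3 ++ w2 ++ w3)).
Definition wA3 := flatten (nseq 5 (w1 ++ winv w2 ++ winv w1 ++ w3 ++ w1 ++ w2)).
Definition wA4 := flatten (nseq 5 (w1 ++ w3 ++ w1 ++ w2 ++ winv w1 ++ winv w3)).

(* Generalising keeps [mulmxA] from unfolding the letters of [w1], [w2], [w3]. *)
Local Ltac by_words :=
  rewrite R1E R2E ?R3E !wmx_inv ?wmx_flatten_nseq !wmx_cat;
  move: (wmx w1) (wmx w2) (wmx w3) (wmx (winv w1)) (wmx (winv w2)) (wmx (winv w3));
  move=> *; rewrite !mulmxA.

Lemma P5E : Pmx p tau ^+ 5 = wmx wP5.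
Proof. by rewrite wmx_flatten_nseq /Pmx /= mulmx1. Qed.

Lemma BmxE : Bmx p tau = wmx wB.
Proof. by rewrite /Bmx; by_words. Qed.

Lemma A1E : A1 p tau = wmx wA1.
Proof. by rewrite /A1; by_words. Qed.

Lemma A2E : A2 p tau = wmx wA2.
Proof. by rewrite /A2; by_words. Qed.

Lemma A3E : A3 p tau = wmx wA3.
Proof. by rewrite /A3; by_words. Qed.

Lemma A4E : A4 p tau = wmx wA4.
Proof. by rewrite /A4; by_words. Qed.
End Words.

(** * The two lattices *)

(* These factorisations of scalar multiples of R1 (for p = 2) and of J^-1 (for
   p = 4) into elements of the two centralisers were found by a computer search
   in the Cayley graph of the subgroup they generate. *)
Definition factors_i : seq (seq letter) :=
  [::
   [:: j; r'; j; r'; j; r'; j'; r; j'; r; j'];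
   [:: r'; j];
   [:: r'; j];
   [:: j'; r'; j'; r'; j; r'; j'; r'; j'; r'; j; r; j; r; j'; r; j; r; j];
   [:: r'; j];
   [:: j; r'; j'; r'; j; r'; j; r'; j'; r; j'; r; j; r; j'];
   [:: j'; r];
   [:: j'; r'; j'; r'; j; r'; j'; r'; j'; r'; j; r; j; r; j'; r; j; r; j];
   [:: j'; r];
   [:: j'; r];
   [:: j; r'; j; r'; j; r'; j'; r; j'; r; j']].
Definition factors_ii1 : seq (seq letter) :=
  [::
   [:: r];
   [:: r];
   [:: j; r'; j'; r'; j; r'; j'];
   [:: j; r; j; r; j'; r'; j'];
   [:: r];
   [:: j; r; j; r; j'; r'; j'];
   [:: j; r; j; r'; j'; r'; j'; r'; j; r; j; r'; j'; r'; j'; r'; j; r; j];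
   [:: j; r; j; r; j'; r'; j']].
Definition factors_ii2 : seq (seq letter) :=
  [::
   [:: j'; r'; j'; r; j; r; j];
   [:: j; r; j; r; j'; r'; j'; r; j; r; j; r; j'; r'; j'; r; j; r; j];
   [:: j'; r'; j'; r'; j; r; j];
   [:: r'];
   [:: j'; r'; j'; r'; j; r; j];
   [:: j'; r'; j; r'; j'; r'; j]].
Definition factors_ii3 : seq (seq letter) :=
  [::
   [:: r'];
   [:: r'];
   [:: j; r'; j'; r'; j'; r; j; r; j; r; j'];
   [:: r];
   [:: j; r'; j'; r'; j'; r; j; r; j; r; j'];
   [:: j; r'; j'; r'; j; r'; j'];
   [:: j; r; j; r'; j'; r'; j'; r'; j; r; j; r'; j'; r'; j'; r'; j; r; j];
   [:: j; r; j'; r; j; r; j'];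
   [:: j; r'; j'; r'; j'; r; j; r; j; r; j'];
   [:: j; r'; j'; r'; j; r'; j']].
Definition factors_ii4 : seq (seq letter) :=
  [::
   [:: j'; r'; j; r'; j'; r'; j];
   [:: j'; r; j; r; j; r; j'; r'; j'; r'; j];
   [:: j'; r; j; r; j'; r; j];
   [:: j; r; j; r'; j'; r'; j'; r'; j; r; j; r'; j'; r'; j'; r'; j; r; j];
   [:: j'; r'; j; r'; j'; r'; j];
   [:: j'; r; j; r; j; r; j'; r'; j'; r'; j];
   [:: r];
   [:: j'; r; j; r; j; r; j'; r'; j'; r'; j];
   [:: r];
   [:: r]].

Lemma zR1K_2 : zmul (zR1i zz2 zz2i) (zR1 zz2 zz2i) = zscal zone.
Proof. by vm_compute. Qed.

Lemma zR1K_4 : zmul (zR1i zz zzi) (zR1 zz zzi) = zscal zone.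
Proof. by vm_compute. Qed.

Section Instances.
Variable R : realType.

Lemma ev_uu2 : ev R zz2 = uu R 2.
Proof. by rewrite ev_zz2 uu2E. Qed.

Lemma ev_uu2i : ev R zz2i = conjc (uu R 2).
Proof. by rewrite ev_zz2i uu2E conj_z12_sq. Qed.

Lemma ev_uu4 : ev R zz = uu R 4.
Proof. by rewrite ev_zz uu4E. Qed.

Lemma ev_uu4i : ev R zzi = conjc (uu R 4).
Proof. by rewrite ev_zzi uu4E conj_z12. Qed.

Lemma generated_2 g : Sgroup 2 (sigma5 R) g ->
  gen (two_stabs 2 (Pmx 2 (sigma5 R) ^+ 5) (Bmx 2 (sigma5 R))) g.
Proof.
rewrite P5E (BmxE ev_uu2 ev_uu2i zR1K_2).
have cert := certificate ev_uu2 ev_uu2i zR1K_2 (wA := wP5) (wB := wB).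
have gR : gen (two_stabs 2 (wmx R 2 wP5) (wmx R 2 wB)) (R1 2 (sigma5 R)).
  by rewrite (R1E R 2); apply: (cert factors_i); vm_compute.
have gJ : gen (two_stabs 2 (wmx R 2 wP5) (wmx R 2 wB)) (Jmx R).
  have -> : Jmx R = wmx R 2 [:: j] by rewrite /= mulmx1.
  (* The extra factor is P^-1, which commutes with P^5. As R1^2 is scalar for p = 2, [factors_i]
     multiplies to a scalar times R1, and the whole list to a scalar times J^-1. *)
  by apply: (cert ([:: j'; r'] :: factors_i)); vm_compute.
exact: (two_stabs_generate ev_uu2 ev_uu2i zR1K_2).
Qed.

(** R1 commutes with itself, hence stabilises its own mirror, so only J needs a certificate. *)
Lemma generated_4 ws w :
  certifies zz zzi w1 w ws [:: j] ->
  forall g, Sgroup 4 (sigma5 R) g ->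
    gen (two_stabs 4 (R1 4 (sigma5 R)) (wmx R 4 w)) g.
Proof.
move=> wsP; apply: (two_stabs_generate ev_uu4 ev_uu4i zR1K_4).
  apply: gen_mem; left; rewrite [X in Stab _ _ X](R1E R 4).
  by apply: (Stab_commute ev_uu4 ev_uu4i zR1K_4); rewrite -R1E.
have -> : Jmx R = wmx R 4 [:: j] by rewrite /= mulmx1.
by rewrite (R1E R 4); apply: (certificate ev_uu4 ev_uu4i zR1K_4 wsP).
Qed.

End Instances.

Theorem theorem11p2 (R : realType) :
  (* (i) Gamma = S(2, sigma5) is generated by Stab(m(P^5)) u Stab(m(B)) *)
  (forall g : 'M[R[i]]_3,
     Sgroup 2 (sigma5 R) g ->
     gen (fun h => Stab (Sgroup 2 (sigma5 R))
                        (mirror (Hmat 2 (sigma5 R)) (Pmx 2 (sigma5 R) ^+ 5)) h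
                 \/ Stab (Sgroup 2 (sigma5 R))
                        (mirror (Hmat 2 (sigma5 R)) (Bmx 2 (sigma5 R))) h) g)
  /\
  (* (ii) Gamma = S(4, sigma5) is generated by Stab(m(R1)) u Stab(m(A)),
     for each of the four choices of A *)
  (forall A : 'M[R[i]]_3,
     (A = A1 4 (sigma5 R) \/ A = A2 4 (sigma5 R) \/
      A = A3 4 (sigma5 R) \/ A = A4 4 (sigma5 R)) ->
     forall g : 'M[R[i]]_3,
       Sgroup 4 (sigma5 R) g ->
       gen (fun h => Stab (Sgroup 4 (sigma5 R))
                          (mirror (Hmat 4 (sigma5 R)) (R1 4 (sigma5 R))) h
                   \/ Stab (Sgroup 4 (sigma5 R))
                          (mirror (Hmat 4 (sigma5 R)) A) h) g).
Proof.
split=> [|A Aw]; first exact: generated_2.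
case: Aw => [->|[->|[->|->]]].
- rewrite (A1E (ev_uu4 R) (ev_uu4i R) zR1K_4); apply: (generated_4 (ws := factors_ii1)).
  by vm_compute.
- rewrite (A2E (ev_uu4 R) (ev_uu4i R) zR1K_4); apply: (generated_4 (ws := factors_ii2)).
  by vm_compute.
- rewrite (A3E (ev_uu4 R) (ev_uu4i R) zR1K_4); apply: (generated_4 (ws := factors_ii3)).
  by vm_compute.
- rewrite (A4E (ev_uu4 R) (ev_uu4i R) zR1K_4); apply: (generated_4 (ws := factors_ii4)).
  by vm_compute.
Qed.
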